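(* Assume $\sigma_1>0$ and $\sigma_2<0$, and consider, for $k\in\overline{D}^{(5)}$, the linear system $\mathcal{A}X=Y+e^{ik^3T}\mathcal{Y}$ for $X=(g_0,g_1,g_2,h_0,h_1,h_2)^\top$ (all evaluated at $(ik^3,T)$) defined in the context. This system is solvable for $X$ if and only if two interface conditions are given. These conditions must be of the form $$\beta_{11}q^{(1)}(0,t)+\beta_{12} q^{(1)}_{x}(0,t)+\beta_{13} q^{(1)}_{xx}(0,t)+\beta_{14}q^{(2)}(0,t)+\beta_{15}q^{(2)}_x(0,t)+\beta_{16}q^{(2)}_{xx}(0,t)=f_1(t),$$ $$\beta_{21}q^{(1)}(0,t)+\beta_{22}q^{(1)}_x(0,t)+\beta_{23} q^{(1)}_{xx}(0,t)+\beta_{24}q^{(2)}(0,t)+\beta_{25}q^{(2)}_x(0,t)+\beta_{26}q^{(2)}_{xx}(0,t)=f_2(t).$$ The system is full rank, that is, solvable for $X$, whenever at least one of the following holds: 1. $\beta_{14}\beta_{21}\neq\beta_{11}\beta_{24}$; 2. $\sigma_1(\beta_{15}\beta_{21}-\beta_{11}\beta_{25})\neq \sigma_2(\beta_{12}\beta_{24}-\beta_{14}\beta_{22})$; 3. $\sigma_1^2(\beta_{16}\beta_{21}-\beta_{11}\beta_{26})+\sigma_1\sigma_2(\beta_{15}\beta_{22}-\beta_{12}\beta_{25})+\sigma_2^2(\beta_{14}\beta_{23}-\beta_{13}\beta_{24})\neq0$; 4. $\sigma_1(\beta_{16}\beta_{22}-\beta_{12}\beta_{26})\neq\sigma_2(\beta_{13}\beta_{25}-\beta_{15}\beta_{23})$;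 5. $\beta_{16}\beta_{23}\neq\beta_{13}\beta_{26}$.
   Context: Interface problem: $q^{(1)}_t=\sigma_1^3 q^{(1)}_{xxx}$ for $x<0$, $0<t\le T$, and $q^{(2)}_t=\sigma_2^3 q^{(2)}_{xxx}$ for $x>0$, $0<t\le T$, where $\sigma_1,\sigma_2$ are nonzero real constants, with initial conditions $q^{(j)}(x,0)=q^{(j)}_0(x)$. It is assumed that $q^{(1)}(\cdot,t),q_0^{(1)}\in S(-\infty,0)$ and $q^{(2)}(\cdot,t),q_0^{(2)}\in S(0,\infty)$, where $S(I)$ is the space of restrictions to $I$ of Schwartz functions, and that the initial data are compatible with the interface conditions. An interface condition is an equation, for all $t$, prescribing a constant-coefficient linear combination of $\partial_x^n q^{(1)}(0,t)$ and $\partial_x^n q^{(2)}(0,t)$, $n=0,1,2$, to equal a given function $f(t)$. Standing assumption: the interface conditions are not such that the problem reduces to a pair of half-line boundary value problems (i.e. such that the problem for $q^{(1)}$ or for $q^{(2)}$ can be solved as a half-line boundary value problem without knowing the other function, the result then being used to solve the other). Notation: $\alpha=e^{2\pi i/3}$; $D=\{k\in\mathbb{C}:\operatorname{Re}(ik^3)<0\}=D^{(1)}\cup D^{(3)}\cup D^{(5)}$ with $D^{(1)}=\{0<\arg k<\pi/3\}$, $D^{(3)}=\{2\pi/3<\arg k<\pi\}$, $D^{(5)}=\{4\pi/3<\arg k<5\pi/3\}$; bars denote closures. Put $$g_n(\omega,T)=\int_0^T e^{\omega s}\partial_x^n q^{(1)}(0,s)\,ds,\quad h_n(\omega,T)=\int_0^T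 e^{\omega s}\partial_x^n q^{(2)}(0,s)\,ds\quad(n=0,1,2),$$ $$\tilde f_j(\omega,T)=\int_0^T e^{\omega s}f_j(s)\,ds,$$ $\hat q^{(1)}(k,T)=\int_{-\infty}^0e^{-ikx}q^{(1)}(x,T)\,dx$ and $\hat q^{(1)}_0(k)=\int_{-\infty}^0e^{-ikx}q^{(1)}_0(x)\,dx$ for $\operatorname{Im}k\ge0$, and $\hat q^{(2)}(k,T)=\int_0^{\infty}e^{-ikx}q^{(2)}(x,T)\,dx$ and $\hat q^{(2)}_0(k)=\int_0^{\infty}e^{-ikx}q^{(2)}_0(x)\,dx$ for $\operatorname{Im}k\le0$. The linear system: for $\sigma_1>0$, $\sigma_2<0$ and $k\in\overline{D}^{(5)}$, the valid global relations are, for $\gamma\in\{\alpha,\alpha^2\}$, $$e^{ik^3T}\hat q^{(1)}(\gamma k/\sigma_1,T)-\hat q^{(1)}_0(\gamma k/\sigma_1)=\sigma_1^3g_2+i\gamma k\sigma_1^2g_1-\gamma^2k^2\sigma_1g_0,$$ $$e^{ik^3T}\hat q^{(2)}(\gamma k/\sigma_2,T)-\hat q^{(2)}_0(\gamma k/\sigma_2)=-\sigma_2^3h_2-i\gamma k\sigma_2^2h_1+\gamma^2k^2\sigma_2h_0,$$ with $g_n,h_n$ evaluated at $(ik^3,T)$. The transform of the $j$-th interface condition is $\sum_{n=0}^2\left(\beta_{j,n+1}g_n+\beta_{j,n+4}h_n\right)=\tilde f_j(ik^3,T)$. The four global relations together with the transforms of the given interface conditions are written $\mathcal{A}X=Y+e^{ik^3T}\mathcal{Y}$,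 where $\mathcal{A}=\mathcal{A}(k)$ is the coefficient matrix, $Y$ collects the known terms ($-\hat q^{(j)}_0$ and $\tilde f_j$) and $\mathcal{Y}$ collects the terms $\hat q^{(j)}(\cdot,T)$. The system is called full rank when $\det\mathcal{A}$, a polynomial in $k$, is not identically zero. *)

(* Defs.v *)
From mathcomp Require Import all_boot all_order all_algebra.
From mathcomp Require Import all_classical all_reals all_analysis.
From mathcomp Require Import complex.

Set Implicit Arguments.
Unset Strict Implicit.
Unset Printing Implicit Defensive.

Import Order.TTheory GRing.Theory Num.Theory.
Import numFieldNormedType.Exports.

Local Open Scope classical_set_scope.
Local Open Scope ring_scope.
Local Open Scope complex_scope.

Section Defs.
Variable R : realType.
Local Notation C := R[i].

Definition re (q : R -> C) (x : R) : R := complex.Re (q x).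
Definition im (q : R -> C) (x : R) : R := complex.Im (q x).

Definition cexp (z : C) : C :=
  (expR (complex.Re z) * cos (complex.Im z))
    +i* (expR (complex.Re z) * sin (complex.Im z)).

Definition cint (D : set R) (q : R -> C) : C :=
  (\int[lebesgue_measure]_(x in D) re q x)
    +i* (\int[lebesgue_measure]_(x in D) im q x).

Definition dx (n : nat) (q : R -> C) (x : R) : C :=
  (derive1n n (re q) x) +i* (derive1n n (im q) x).

Definition rschwartz (u : R -> R) : Prop :=
  forall n m : nat, (forall x, derivable (derive1n n u) x 1) /\
    exists M : R, forall x, `|x| ^+ m * `|derive1n n u x| <= M.

(* An element of S(-oo,0) or S(0,oo) is represented by a Schwartz function on
   the whole line extending it. Only the restriction to the half-line matters
   below: it determines both the half-line transforms and the traces at 0. *)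
Definition schwartz (q : R -> C) : Prop := rschwartz (re q) /\ rschwartz (im q).

Definition continuous_on (D : set R) (f : R -> C) : Prop :=
  {within D, continuous (re f)} /\ {within D, continuous (im f)}.

Definition alpha : C := cexp (0 +i* (2 * pi / 3)).

Definition D5 : set C^o :=
  [set k | exists r theta : R,
    [/\ 0 < r, 4 * pi / 3 < theta, theta < 5 * pi / 3 &
        k = r%:C * cexp (0 +i* theta)]].

Definition omega (k : C) : C := 'i%C * k ^+ 3.

Definition hat_left (q : R -> C) (k : C) : C :=
  cint `]-oo, 0] (fun x => cexp (- 'i%C * k * x%:C) * q x).

Definition hat_right (q : R -> C) (k : C) : C :=
  cint `[0, +oo[ (fun x => cexp (- 'i%C * k * x%:C) * q x).

Definition tilde (f : R -> C) (w : C) (T : R) : C :=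
  cint `[0, T] (fun s => cexp (w * s%:C) * f s).

(* Row j of a matrix beta : 'M_(m, 3 + 3) holds the coefficients of the j-th of
   m interface conditions: columns 0, 1, 2 multiply q1, q1_x, q1_xx at x = 0,
   and columns 3, 4, 5 multiply q2, q2_x, q2_xx. *)
Definition interface_conditions (m : nat) (beta : 'M[C]_(m, 3 + 3))
    (q1 q2 : R -> C) (c : 'I_m -> C) : Prop :=
  forall j : 'I_m,
    \sum_(n < 3) (beta j (lshift 3 n) * dx n q1 0
                  + beta j (rshift 3 n) * dx n q2 0) = c j.

(* beta_{jn}, with indices starting at 1. *)
Definition coef (beta : 'M[C]_(2, 3 + 3)) (j n : nat) : C :=
  beta (inord j.-1) (inord n.-1).

(* The conditions are equivalent to two conditions, the first one a boundary
   condition for one function only, the second one a boundary condition for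
   the other function once the first function is known. When sigma1 > 0 and
   sigma2 < 0, each half-line problem takes exactly one boundary condition. *)
Definition half_line_pair (m : nat) (beta : 'M[C]_(m, 3 + 3)) : Prop :=
  exists b b' : 'rV[C]_(3 + 3),
    (beta == col_mx b b')%MS /\
    ([/\ lsubmx b != 0, rsubmx b = 0 & rsubmx b' != 0] \/
     [/\ rsubmx b != 0, lsubmx b = 0 & lsubmx b' != 0]).

(* Row j is the right-hand side of the global relation for q1 with
   gamma = alpha ^+ j.+1, as a form in (g_0, g_1, g_2). That for q2 is the
   opposite, with sigma2 in place of sigma1. *)
Definition relation_mx (sigma : R) (k : C) : 'M[C]_(2, 3) :=
  \matrix_(j, n) let gamma := alpha ^+ j.+1 in
    [:: - (gamma ^+ 2 * k ^+ 2 * sigma%:C);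
        'i%C * gamma * k * sigma%:C ^+ 2;
        sigma%:C ^+ 3]`_n.

Section System.
Variables (sigma1 sigma2 T : R) (m : nat) (beta : 'M[C]_(m, 3 + 3)).

Definition calA (k : C) : 'M[C]_(2 + 2 + m, 3 + 3) :=
  col_mx (block_mx (relation_mx sigma1 k) 0 0 (- relation_mx sigma2 k)) beta.

Record data := Data {
  q1_0 : R -> C; q2_0 : R -> C;
  q1_T : R -> C; q2_T : R -> C;
  fint : 'I_m -> R -> C }.

Definition admissible (d : data) : Prop :=
  [/\ schwartz (q1_0 d) /\ schwartz (q2_0 d),
      schwartz (q1_T d) /\ schwartz (q2_T d),
      forall j, continuous_on `[0, T] (fint d j) &
      interface_conditions beta (q1_0 d) (q2_0 d) (fun j => fint d j 0) /\
      interface_conditions beta (q1_T d) (q2_T d) (fun j => fint d j T)].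

Definition rhs_Y (d : data) (k : C) : 'cV[C]_(2 + 2 + m) :=
  col_mx
    (col_mx (\col_(j < 2) - hat_left (q1_0 d) (alpha ^+ j.+1 * k / sigma1%:C))
            (\col_(j < 2) - hat_right (q2_0 d) (alpha ^+ j.+1 * k / sigma2%:C)))
    (\col_(j < m) tilde (fint d j) (omega k) T).

Definition rhs_calY (d : data) (k : C) : 'cV[C]_(2 + 2 + m) :=
  col_mx
    (col_mx (\col_(j < 2) hat_left (q1_T d) (alpha ^+ j.+1 * k / sigma1%:C))
            (\col_(j < 2) hat_right (q2_T d) (alpha ^+ j.+1 * k / sigma2%:C)))
    0.

(* q_j(., T) is treated as data on the same footing as the initial values. *)
Definition solvable_at (k : C) : Prop :=
  forall d : data, admissible d ->
    exists! X : 'cV[C]_(3 + 3),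
      calA k *m X = rhs_Y d k + cexp (omega k * T%:C) *: rhs_calY d k.

(* Finitely many exceptional k are allowed: det A is a polynomial in k which,
   even when it is not identically zero, vanishes at k = 0. *)
Definition system_solvable : Prop :=
  finite_set [set k : C | closure D5 k /\ ~ solvable_at k].

End System.

(* With two interface conditions, A is square. *)
Definition full_rank (sigma1 sigma2 : R) (beta : 'M[C]_(2, 3 + 3)) : Prop :=
  exists k : C, \det (calA sigma1 sigma2 beta k : 'M[C]_6) != 0.

End Defs.

(* Main.v *)
Require Import Defs.
From mathcomp Require Import all_boot all_order all_algebra.
From mathcomp Require Import all_classical all_reals all_analysis.
From mathcomp Require Import complex ring lra.
Set Implicit Arguments.
Unset Strict Implicit.
Unset Printing Implicit Defensive.

Import Order.TTheory GRing.Theory Num.Theory.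
Local Open Scope ring_scope.
Local Open Scope complex_scope.

(** The right-hand sides of the two relations for q1 are, up to a common factor,
    the values at gamma = alpha, alpha^2 of a quadratic in gamma whose
    coefficients are multiples of g_0, g_1, g_2. A quadratic vanishing at both
    primitive cube roots of unity is a multiple of 1 + gamma + gamma^2, so for
    k <> 0 the homogeneous relations leave a single degree of freedom:
    (g_0, g_1, g_2) is proportional to (1, y, y^2) with y = ik/sigma1, the trace
    at 0 of the travelling wave exp(yx) (lemma [relation_kernel]). The same
    holds for (h_0, h_1, h_2) with ik/sigma2. Hence the four relations have a
    kernel of dimension exactly two, spanned by two travelling waves, and the
    interface conditions have to determine two amplitudes.

    With two conditions, substituting the waves gives a 2 x 2 system whose
    determinant is a polynomial of degree at most 4 in the rescaled frequency
    ik/(sigma1 sigma2) ([interface_det]). Its five coefficients are, up to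
    nonzero factors, the five quantities compared in the criterion. If one of
    them is nonzero, the determinant has finitely many roots, and away from
    these and from k = 0 the matrix is invertible ([calA_unitmx]).

    The number of conditions is forced in both directions. With fewer than two,
    the matrix has a kernel and solutions are never unique. With more than two,
    it has a left null vector, which must charge some interface condition since
    the relations are linearly independent for k <> 0; a source f_j adapted to k
    then violates the corresponding compatibility condition. As the closure of
    D5 is infinite, neither defect can be absorbed by finitely many exceptional
    k. Finally, requiring q and q_x to be continuous across the interface is a
    pair of conditions that couples both sides and is solvable because
    sigma1 <> sigma2. *)

(** * The complex exponential and the cube root of unity *)

Section ComplexExponential.
Variable R : realType.
Implicit Types (z w : R[i]) (x y : R).

Lemma cexpD z w : cexp (z + w) = cexp z * cexp w.
Proof.
case: z w => [a b] [c d]; rewrite /cexp /= expRD cosD sinD.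
by apply/eqP; rewrite eq_complex /=; apply/andP; split; apply/eqP; ring.
Qed.

Lemma cexp0 : cexp (0 : R[i]) = 1.
Proof. by rewrite /cexp /= expR0 cos0 sin0 mulr1 mulr0. Qed.

Lemma cexp_neq0 z : cexp z != 0.
Proof.
apply/eqP => z0; have := cexpD z (- z).
by rewrite z0 mul0r subrr cexp0 => /eqP; rewrite oner_eq0.
Qed.

Lemma re_cexpM z x :
  complex.Re (cexp (z * x%:C))
  = expR (complex.Re z * x) * cos (complex.Im z * x).
Proof. by case: z => a b; rewrite /cexp /= !mulr0 subr0 add0r. Qed.

Lemma im_cexpM z x :
  complex.Im (cexp (z * x%:C))
  = expR (complex.Re z * x) * sin (complex.Im z * x).
Proof. by case: z => a b; rewrite /cexp /= !mulr0 subr0 add0r. Qed.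

Local Notation alpha := (@alpha R).

Lemma alpha_cubed : alpha ^+ 3 = 1.
Proof.
rewrite !exprS expr0 mulr1 -!cexpD /cexp /= !addr0 expR0 !mul1r.
have -> : 2 * pi / 3 + (2 * pi / 3 + 2 * pi / 3) = pi *+ 2 :> R by field.
by rewrite cos2pi sin2pi.
Qed.

Lemma alpha_neq1 : alpha != 1.
Proof.
have pi0 := pi_gt0 R.
rewrite eq_complex negb_and /= expR0 !mul1r; apply/orP; right.
by rewrite gt_eqF// sin_gt0_pi//; apply/andP; split; lra.
Qed.

Lemma alpha_neq0 : alpha != 0.
Proof. exact: cexp_neq0. Qed.

Lemma alpha_sum : 1 + alpha + alpha ^+ 2 = 0.
Proof.
have /eqP : (alpha - 1) * (1 + alpha + alpha ^+ 2) = 0.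
  have -> : (alpha - 1) * (1 + alpha + alpha ^+ 2) = alpha ^+ 3 - 1 by ring.
  by rewrite alpha_cubed subrr.
by rewrite mulf_eq0 subr_eq0 (negbTE alpha_neq1) => /eqP.
Qed.

End ComplexExponential.

(** * Finite sets of frequencies *)

Section FiniteSets.
Variable R : realType.
Local Notation C := R[i].

(** The device by which finitely many exceptional frequencies are avoided, on
    the bisector of D5 as on the positive real axis: a ray is infinite. *)
Lemma ray_escapes_finite_set (S : set C) (e : C) :
  finite_set S -> e != 0 -> exists n : nat, ~ S (n.+1%:R%:C * e).
Proof.
move=> finS e0; apply: contrapT => /forallNP allS.
have {}allS n : S (n.+1%:R%:C * e) by apply: contrapT; exact: allS.
apply: infinite_nat.
rewrite (_ : setT = (fun n : nat => n.+1%:R%:C * e) @^-1` S)%classic;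
  last first.
  by apply/seteqP; split => // n _; exact: allS.
apply: finite_preimage finS => n p _ _ /(mulIf e0) [] /eqP.
by rewrite eqr_nat => /eqP [].
Qed.

Lemma closure_D5_escapes_finite_set (S : set C) :
  finite_set S -> exists k : C, [/\ k != 0, closure (@D5 R) k & ~ S k].
Proof.
move=> finS; have pi0 := pi_gt0 R.
(* The bisector of the sector 4 pi / 3 < arg k < 5 pi / 3. *)
have [n Sn] := ray_escapes_finite_set finS (cexp_neq0 (0 +i* (3 * pi / 2))).
exists (n.+1%:R%:C * cexp (0 +i* (3 * pi / 2))); split => //.
  by rewrite mulf_neq0 ?cexp_neq0// eq_complex /= pnatr_eq0.
apply: subset_closure; exists n.+1%:R, (3 * pi / 2).
by split; [exact: ltr0Sn | lra | lra | by []].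
Qed.

Lemma finite_roots (p : {poly C}) :
  p != 0 -> finite_set [set z | root p z]%classic.
Proof.
move=> p0; apply: contrapT => /infinite_set_fsetP /(_ (size p)) [B Bp].
apply/negP; rewrite -ltnNge; apply: max_poly_roots => //.
  by apply/allP => z /Bp.
exact: finmap.fset_uniq.
Qed.

End FiniteSets.

(** * Data carried by the interface sources alone *)

Section TestData.
Variable R : realType.
Local Notation C := R[i].
Implicit Types (T x : R) (k w : C).
Import numFieldNormedType.Exports.
Local Open Scope classical_set_scope.

Lemma Rintegral_bump T : 0 < T ->
  \int[lebesgue_measure]_(x in `[0, T]) (x * (T - x)) = T ^+ 3 / 6.
Proof.
move=> T0; pose p : {poly R} := (T / 2) *: 'X^2 - 3^-1 *: 'X^3.
rewrite /Rintegral (@continuous_FTC2 _ _ (horner p)) //.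
- by rewrite -EFinB /= !hornerE /=; field.
- apply/continuous_subspaceT => x; apply: cvgM; first exact: cvg_id.
  by apply: cvgB; [exact: cvg_cst | exact: cvg_id].
- split => [x _||] //.
  + exact/cvg_at_right_filter/continuous_horner.
  + exact/cvg_at_left_filter/continuous_horner.
- by move=> x _; rewrite -derivE /p !poly.derivE !hornerE /=; field.
Qed.

(** The exponential cancels the kernel of the transform at frequency w, which
    leaves the integral of a function positive on ]0, T[; the factor x (T - x)
    makes the source vanish at both ends, as compatibility with zero initial and
    final data requires. *)
Definition resonant_source T w x : C := (x * (T - x))%:C * cexp (- w * x%:C).

Lemma resonant_source_continuous T w D : continuous_on D (resonant_source T w).
Proof.
have bump_cont x : x * (T - x) @[x --> x] --> x * (T - x).
  apply: cvgM; first exact: cvg_id.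
  by apply: cvgB; [exact: cvg_cst | exact: cvg_id].
have lin_cont (a x : R) : a * x @[x --> x] --> a * x.
  by apply: cvgM; [exact: cvg_cst | exact: cvg_id].
have exp_cont (a x : R) : expR (a * x) @[x --> x] --> expR (a * x).
  by apply: continuous_comp; [exact: lin_cont | exact: continuous_expR].
split; apply/continuous_subspaceT => x; rewrite /re /im.
- have -> : (fun x => complex.Re (resonant_source T w x)) = fun x =>
     x * (T - x) * (expR (complex.Re (- w) * x) * cos (complex.Im (- w) * x)).
    by apply/funext => y; rewrite /resonant_source -re_cexpM;
       case: (cexp _) => a b /=; rewrite mul0r subr0.
  apply: cvgM; [exact: bump_cont|apply: cvgM; first exact: exp_cont].
  by apply: continuous_comp; [exact: lin_cont | exact: continuous_cos].
- have -> : (fun x => complex.Im (resonant_source T w x)) = fun x =>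
     x * (T - x) * (expR (complex.Re (- w) * x) * sin (complex.Im (- w) * x)).
    by apply/funext => y; rewrite /resonant_source -im_cexpM;
       case: (cexp _) => a b /=; rewrite mul0r addr0.
  apply: cvgM; [exact: bump_cont|apply: cvgM; first exact: exp_cont].
  by apply: continuous_comp; [exact: lin_cont | exact: continuous_sin].
Qed.

Lemma tilde_resonant_source T w : 0 < T ->
  tilde (resonant_source T w) w T = (T ^+ 3 / 6)%:C.
Proof.
move=> T0; rewrite /tilde /cint /re /im.
have E x : cexp (w * x%:C) * resonant_source T w x = (x * (T - x))%:C.
  by rewrite mulrCA -cexpD mulNr subrr cexp0 mulr1.
under eq_Rintegral do rewrite E.
under [X in _ +i* X]eq_Rintegral do rewrite E.
by rewrite Rintegral_bump// Rintegral_cst//= mul0r.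
Qed.

Lemma resonant_source_ends T w :
  resonant_source T w 0 = 0 /\ resonant_source T w T = 0.
Proof.
split; rewrite /resonant_source.
  by rewrite (mul0r (T - 0)); exact: mul0r.
by rewrite subrr mulr0; exact: mul0r.
Qed.

Lemma continuous_on_zero D : continuous_on D (fun _ : R => 0 : C).
Proof. by split; apply/continuous_subspaceT => x; exact: cvg_cst. Qed.

Lemma cint_mulr0 (D : set R) (g : R -> C) : cint D (fun x => g x * 0) = 0.
Proof.
rewrite (_ : (fun x => _) = fun=> 0); last by apply/funext => x; rewrite mulr0.
by rewrite /cint /re /im /Rintegral /= integral0.
Qed.

Lemma tilde_zero T w : tilde (fun _ : R => 0 : C) w T = 0.
Proof. exact: cint_mulr0. Qed.

Lemma hat_left_zero k : hat_left (fun _ : R => 0 : C) k = 0.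
Proof. exact: cint_mulr0. Qed.

Lemma hat_right_zero k : hat_right (fun _ : R => 0 : C) k = 0.
Proof. exact: cint_mulr0. Qed.

Lemma derive1n_zero n : derive1n n (fun _ : R => 0 : R) = fun _ => 0.
Proof.
elim: n => [//|n IH]; rewrite derive1nS IH; apply/funext => x.
by rewrite derive1E derive_cst.
Qed.

Lemma dx_zero n x : dx n (fun _ : R => 0 : C) x = 0.
Proof. by rewrite /dx /re /im /= derive1n_zero. Qed.

Lemma schwartz_zero : schwartz (fun _ : R => 0 : C).
Proof.
suff H : rschwartz (fun _ : R => 0 : R) by [].
move=> n m; rewrite derive1n_zero; split => [x|]; first exact: derivable_cst.
by exists 0 => x; rewrite normr0 mulr0.
Qed.

(** With both functions zero at times 0 and T, the only inhomogeneous terms of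
    the system are the transforms of the sources. *)
Definition source_data m (f : 'I_m -> R -> C) : data R m :=
  Data (fun _ => 0) (fun _ => 0) (fun _ => 0) (fun _ => 0) f.

Lemma admissible_source_data T m (beta : 'M[C]_(m, 3 + 3))
    (f : 'I_m -> R -> C) :
  (forall j, continuous_on `[0, T] (f j)) ->
  (forall j, f j 0 = 0 /\ f j T = 0) ->
  admissible T beta (source_data f).
Proof.
move=> fc f0; have S0 := schwartz_zero.
by split => //=; split => j /=; have [f00 fT0] := f0 j; rewrite ?f00 ?fT0;
   apply: big1 => n _; rewrite !dx_zero !mulr0 addr0.
Qed.

Lemma rhs_source_data sigma1 sigma2 T m (f : 'I_m -> R -> C) k :
  rhs_Y sigma1 sigma2 T (source_data f) k
    + cexp (omega k * T%:C) *: rhs_calY sigma1 sigma2 (source_data f) k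
  = col_mx 0 (\col_j tilde (f j) (omega k) T).
Proof.
rewrite /rhs_Y /rhs_calY scale_col_mx add_col_mx scaler0 addr0 /=.
congr col_mx; rewrite scale_col_mx add_col_mx -[RHS]col_mx0.
by congr col_mx; apply/colP => j;
  rewrite !mxE ?hat_left_zero ?hat_right_zero oppr0 mulr0 addr0.
Qed.

End TestData.

(** * Kernel and cokernel of the global relations *)

Section Kernels.
Variable R : realType.
Local Notation C := R[i].
Implicit Types (s : R) (k x : C).

(** The traces at 0 of the function exp(xt) and of its first two derivatives
    in t. *)
Definition jet x : 'cV[C]_3 := \col_n x ^+ n.

Lemma real_neq0 s : s != 0 -> s%:C != 0 :> C.
Proof. by move=> s0; rewrite eq_complex /= negb_and s0. Qed.

Lemma relation_mxE s k (X : 'cV[C]_3) (j : 'I_2) :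
  let gamma := @alpha R ^+ j.+1 in
  (relation_mx s k *m X) j 0 =
    - (k ^+ 2 * s%:C * X 0 0) * gamma ^+ 2
    + 'i%C * k * s%:C ^+ 2 * X 1 0 * gamma + s%:C ^+ 3 * X (inord 2) 0.
Proof.
rewrite /= !mxE !big_ord_recr big_ord0 /= !mxE /= add0r.
have -> : widen_ord (leqnSn 2) (widen_ord (leqnSn 1) ord_max) = 0 :> 'I_3.
  exact/val_inj.
have -> : widen_ord (leqnSn 2) (ord_max : 'I_2) = 1 :> 'I_3 by exact/val_inj.
have -> : (ord_max : 'I_3) = inord 2 by apply/val_inj; rewrite /= inordK.
by ring.
Qed.

(** Such a quadratic is a multiple of gamma^2 + gamma + 1, the quadratic with
    the two primitive cube roots of unity as roots. *)
Lemma quadratic_cube_roots (a b c : C) :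
  (forall j : 'I_2, let gamma := @alpha R ^+ j.+1 in
     a * gamma ^+ 2 + b * gamma + c = 0) -> b = a /\ c = a.
Proof.
move=> H; have /= := H 0; have /= := H 1; rewrite expr1.
set z := @alpha R => H2 H1.
have z0 : z != 0 := alpha_neq0 R.
have z1 : z - 1 != 0 by rewrite subr_eq0; exact: alpha_neq1.
have zs : z ^+ 2 = - 1 - z.
  apply/eqP; rewrite -subr_eq0 -[X in _ == X](alpha_sum R) -/z.
  by apply/eqP; ring.
have z3 : (z ^+ 2) ^+ 2 = z by rewrite -exprM exprS alpha_cubed mulr1.
have ba : b = a.
  apply/eqP; rewrite -subr_eq0; apply/eqP.
  have : (b - a) * (z * (z - 1)) = 0.
    (* The difference of the values at z^2 and z, where (z^2)^2 = z. *)
    transitivity ((a * (z ^+ 2) ^+ 2 + b * z ^+ 2 + c)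
      - (a * z ^+ 2 + b * z + c) - a * ((z ^+ 2) ^+ 2 - z)); first by ring.
    by rewrite H1 H2 z3; ring.
  by move/eqP; rewrite !mulf_eq0 (negbTE z0) (negbTE z1) !orbF => /eqP.
split=> //; move: H1; rewrite ba zs => E; apply/eqP; rewrite -subr_eq0 -E.
by apply/eqP; ring.
Qed.

(** Read as a quadratic in gamma, the relation has the coefficients
    - k^2 s g_0, i k s^2 g_1 and s^3 g_2, which must therefore be equal. *)
Lemma relation_kernel s k (X : 'cV[C]_3) : s != 0 -> k != 0 ->
  relation_mx s k *m X = 0 -> X = X 0 0 *: jet ('i%C * k / s%:C).
Proof.
move=> s0 k0 RX; have sC := real_neq0 s0.
have [j|E1 E2] := @quadratic_cube_roots (- (k ^+ 2 * s%:C * X 0 0))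
  ('i%C * k * s%:C ^+ 2 * X 1 0) (s%:C ^+ 3 * X (inord 2) 0).
  by have /= <- := relation_mxE s k X j; rewrite RX mxE.
have i2 : 'i%C ^+ 2 = -1 :> C := sqr_i R.
have i0 : 'i%C != 0 :> C := neq0Ci _.
apply/colP => n; rewrite !mxE.
case: n => [[|[|[|//]]] ltn3] /=.
- by rewrite expr0 mulr1; congr (X _ _); exact/val_inj.
- rewrite (_ : Ordinal ltn3 = 1); last exact/val_inj.
  have c0 : 'i%C * k * s%:C ^+ 2 != 0 :> C by rewrite !mulf_neq0// expf_neq0.
  apply: (mulfI c0); rewrite E1 expr1.
  transitivity ('i%C ^+ 2 * (k ^+ 2 * s%:C * X 0 0)); first by rewrite i2; ring.
  by field.
- rewrite (_ : Ordinal ltn3 = inord 2); last first.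
    by apply/val_inj; rewrite /= inordK.
  apply: (mulfI (expf_neq0 3 sC)); rewrite E2 exprMn [in RHS]exprMn i2.
  by field.
Qed.

(** The first and last columns are - k^2 s (alpha^2, alpha^4) and s^3 (1, 1),
    which are independent because alpha^4 = alpha differs from alpha^2. *)
Lemma relation_mx_row_free s k : s != 0 -> k != 0 -> row_free (relation_mx s k).
Proof.
move=> s0 k0; have sC := real_neq0 s0.
rewrite -kermx_eq0; apply/negPn/negP => /rowV0Pn [u /sub_kermxP uR /eqP]; apply.
have := congr1 (fun M : 'rV_3 => M 0 0) uR.
have := congr1 (fun M : 'rV_3 => M 0 (inord 2)) uR.
rewrite !mxE !big_ord_recl !big_ord0 !mxE /= inordK //= !addr0 expr1.
set z := @alpha R; set a := u 0 0; set b := u _ _ => E1 E2.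
have z0 : z != 0 := alpha_neq0 R.
have z1 : z - 1 != 0 by rewrite subr_eq0; exact: alpha_neq1.
have z4 : (z ^+ 2) ^+ 2 = z by rewrite -exprM exprS alpha_cubed mulr1.
have ab : b = - a.
  apply/eqP; rewrite -addr_eq0; apply/eqP/(mulIf (expf_neq0 3 sC)).
  by rewrite mul0r -E1; ring.
have a0 : a = 0.
  have c0 : k ^+ 2 * s%:C * z * (z - 1) != 0 by rewrite !mulf_neq0// expf_neq0.
  apply: (mulIf c0); rewrite mul0r -[RHS]oppr0 -E2 ab z4.
  by ring.
apply/rowP => j; rewrite mxE; case: j => [[|[|//]] lt].
  by rewrite -[RHS]a0; congr (u _ _); exact/val_inj.
by rewrite -[RHS]oppr0 -a0 -ab; congr (u _ _); exact/val_inj.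
Qed.

End Kernels.

(** * The determinant of the interface conditions *)

Lemma exists_unique_unitmx (F : fieldType) n (A : 'M[F]_n) (b : 'cV[F]_n) :
  A \in unitmx -> exists! X, A *m X = b.
Proof.
move=> Au; exists (invmx A *m b); split; first by rewrite mulKVmx.
by move=> X <-; rewrite mulKmx.
Qed.

Lemma homogeneous_system2 (F : fieldType) (p0 p1 q0 q1 c1 c2 : F) :
  p0 * q1 - p1 * q0 != 0 -> c1 * p0 + c2 * q0 = 0 -> c1 * p1 + c2 * q1 = 0 ->
  c1 = 0 /\ c2 = 0.
Proof.
move=> det0 E0 E1; split; apply: (mulIf det0); rewrite mul0r.
  transitivity ((c1 * p0 + c2 * q0) * q1 - (c1 * p1 + c2 * q1) * q0).
    by ring.
  by rewrite E0 E1 !mul0r subrr.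
transitivity ((c1 * p1 + c2 * q1) * p0 - (c1 * p0 + c2 * q0) * p1).
  by ring.
by rewrite E0 E1 !mul0r subrr.
Qed.

Lemma coef_quadratics_eq0 (F : fieldType) (a b c d : nat -> F) :
  (\poly_(n < 3) a n) * (\poly_(n < 3) b n)
    - (\poly_(n < 3) c n) * (\poly_(n < 3) d n) = 0 ->
  [/\ a 0%N * b 0%N = c 0%N * d 0%N,
      a 0%N * b 1%N + a 1%N * b 0%N = c 0%N * d 1%N + c 1%N * d 0%N,
      a 0%N * b 2%N + a 1%N * b 1%N + a 2%N * b 0%N
        = c 0%N * d 2%N + c 1%N * d 1%N + c 2%N * d 0%N,
      a 1%N * b 2%N + a 2%N * b 1%N = c 1%N * d 2%N + c 2%N * d 1%N &
      a 2%N * b 2%N = c 2%N * d 2%N].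
Proof.
move=> /eqP; rewrite subr_eq0 => /eqP eq_prod.
have coefs n := congr1 (fun p : {poly F} => p`_n) eq_prod.
split; [have := coefs 0%N | have := coefs 1%N | have := coefs 2%N
       | have := coefs 3%N | have := coefs 4%N];
by rewrite !coefM !big_ord_recl !big_ord0 !coef_poly /=
  ?mul0r ?mulr0 ?add0r ?addr0 ?addrA.
Qed.

Lemma eq_from_scaled (F : fieldType) (c x y a b : F) :
  c != 0 -> a = b -> c * (x - y) = a - b -> x = y.
Proof.
move=> c0 -> /eqP; rewrite subrr mulf_eq0 (negbTE c0) subr_eq0.
by move/eqP.
Qed.

Section WellPosedness.
Variable R : realType.
Local Notation C := R[i].
Implicit Types (s : R) (k x : C).

(** The symbol of the boundary operator with coefficients b. The scale s makes
    the symbols for both sides functions of one variable: at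
    x = ik/(sigma1 sigma2), the wave numbers ik/sigma1 and ik/sigma2 are
    sigma2 x and sigma1 x, which also keeps denominators out of the
    coefficients. *)
Definition symbol s (b : 'rV[C]_3) : {poly C} :=
  \poly_(n < 3) (b 0 (inord n) * s%:C ^+ n).

Lemma mulmx_jet (b : 'rV[C]_3) s x :
  (b *m jet (s%:C * x)) 0 0 = (symbol s b).[x].
Proof.
rewrite /symbol horner_poly mxE; apply: eq_bigr => n _.
by rewrite inord_val mxE exprMn mulrA.
Qed.

(** The determinant of the linear system for the amplitudes of the two waves. *)
Definition interface_det sigma1 sigma2 (beta : 'M[C]_(2, 3 + 3)) : {poly C} :=
  let P j := symbol sigma2 (lsubmx (row j beta)) in
  let Q j := symbol sigma1 (rsubmx (row j beta)) in
  P (inord 0) * Q (inord 1) - P (inord 1) * Q (inord 0).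

Variables (sigma1 sigma2 : R).
Hypotheses (sigma1_neq0 : sigma1 != 0) (sigma2_neq0 : sigma2 != 0).

(** A null vector consists of one travelling wave on each side, with amplitudes
    c1 and c2 constrained by the interface conditions. *)
Lemma calA_kernel m (beta : 'M[C]_(m, 3 + 3)) k (X : 'cV[C]_(3 + 3)) : k != 0 ->
  calA sigma1 sigma2 beta k *m X = 0 ->
  let kappa := 'i%C * k / (sigma1%:C * sigma2%:C) in
  exists c1 c2 : C,
    X = col_mx (c1 *: jet (sigma2%:C * kappa))
               (c2 *: jet (sigma1%:C * kappa)) /\
    forall j, c1 * (symbol sigma2 (lsubmx (row j beta))).[kappa]
              + c2 * (symbol sigma1 (rsubmx (row j beta))).[kappa] = 0.
Proof.
move=> k0 + kappa; rewrite -[X]vsubmxK; set X1 := usubmx X; set X2 := dsubmx X.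
rewrite mul_col_mx mul_block_col !mul0mx addr0 add0r => AX0.
have [RX0 betaX] :
    col_mx (relation_mx sigma1 k *m X1) (- relation_mx sigma2 k *m X2) = 0
    /\ beta *m col_mx X1 X2 = 0.
  by apply: eq_col_mx; rewrite col_mx0.
have [R1 R2] :
    relation_mx sigma1 k *m X1 = 0 /\ - relation_mx sigma2 k *m X2 = 0.
  by apply: eq_col_mx; rewrite col_mx0.
have s1C := real_neq0 sigma1_neq0; have s2C := real_neq0 sigma2_neq0.
have e1 : 'i%C * k / sigma1%:C = sigma2%:C * kappa.
  by rewrite /kappa; field; rewrite s1C s2C.
have e2 : 'i%C * k / sigma2%:C = sigma1%:C * kappa.
  by rewrite /kappa; field; rewrite s1C s2C.
have {}R2 : relation_mx sigma2 k *m X2 = 0.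
  by apply/eqP; rewrite -oppr_eq0 -mulNmx R2.
have := relation_kernel sigma1_neq0 k0 R1.
have := relation_kernel sigma2_neq0 k0 R2.
rewrite e1 e2; set c2 := X2 0 0; set c1 := X1 0 0 => X2E X1E.
exists c1, c2; split; first by rewrite -X1E -X2E.
move=> j; rewrite -!mulmx_jet.
have /(congr1 (fun M : 'M[C]_1 => M 0 0)) := congr1 (row j) betaX.
rewrite row_mul -[row j beta]hsubmxK mul_row_col X1E X2E -!scalemxAr.
rewrite row_mxKl row_mxKr [LHS]mxE [X in X + _]mxE [X in _ + X]mxE => ->.
by rewrite !mxE.
Qed.

Lemma calA_unitmx (beta : 'M[C]_(2, 3 + 3)) k : k != 0 ->
  ~~ root (interface_det sigma1 sigma2 beta)
       ('i%C * k / (sigma1%:C * sigma2%:C)) ->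
  (calA sigma1 sigma2 beta k : 'M[C]_6) \in unitmx.
Proof.
set kappa := _ / _ => k0 rootN; rewrite unitmxE unitfE -det_tr.
apply/negP => /det0P [v v0 /(congr1 trmx)].
rewrite trmx_mul trmxK trmx0 => Av.
have [c1 [c2 [vE]]] := calA_kernel k0 Av; rewrite -/kappa => eqs.
move: rootN; rewrite /root /interface_det hornerD hornerN !hornerM => det0.
have [c10 c20] := homogeneous_system2 det0 (eqs (inord 0)) (eqs (inord 1)).
move/eqP: v0; apply; apply: trmx_inj.
by rewrite trmx0 vE c10 c20 !scale0r col_mx0.
Qed.

Lemma finite_singular_set (beta : 'M[C]_(2, 3 + 3)) :
  interface_det sigma1 sigma2 beta != 0 ->
  finite_set
    [set k | (calA sigma1 sigma2 beta k : 'M[C]_6) \notin unitmx]%classic.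
Proof.
move=> det0.
have s1C := real_neq0 sigma1_neq0; have s2C := real_neq0 sigma2_neq0.
have i0 : 'i%C != 0 :> C by exact: neq0Ci.
pose kappa k : C := 'i%C * k / (sigma1%:C * sigma2%:C).
have finK : finite_set (kappa @^-1`
    [set z | root (interface_det sigma1 sigma2 beta) z])%classic.
  apply: finite_preimage (finite_roots det0) => x y _ _ /mulIf.
  by move/(_ (invr_neq0 (mulf_neq0 s1C s2C)))/(mulfI i0).
apply: (@sub_finite_set _ _ ([set 0] `|` _)%classic); last first.
  by rewrite finite_setU; split; [exact: finite_set1 | exact: finK].
move=> k /= Asing; have [->|k0] := eqVneq k 0; [by left | right].
by apply: contraNT Asing; exact: calA_unitmx.
Qed.

Lemma solvable_at_unitmx T (beta : 'M[C]_(2, 3 + 3)) k :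
  (calA sigma1 sigma2 beta k : 'M[C]_6) \in unitmx ->
  solvable_at sigma1 sigma2 T beta k.
Proof.
move=> Au d _; set b := _ + _.
refine (@exists_unique_unitmx _ 6 _ b Au).
Qed.

Lemma well_posed T (beta : 'M[C]_(2, 3 + 3)) :
  interface_det sigma1 sigma2 beta != 0 ->
  full_rank sigma1 sigma2 beta /\ system_solvable sigma1 sigma2 T beta.
Proof.
move=> /finite_singular_set finS; split.
  have [n /negP] := ray_escapes_finite_set finS (oner_neq0 C).
  by rewrite negbK unitmxE unitfE; exists (n.+1%:R%:C * 1).
apply: (sub_finite_set _ finS) => k [_ nsol] /=.
by apply/negP => /(@solvable_at_unitmx T).
Qed.

Lemma symbol_lsubmx s (beta : 'M[C]_(2, 3 + 3)) (j : nat) :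
  symbol s (lsubmx (row (inord j) beta))
  = \poly_(n < 3) (coef beta j.+1 n.+1 * s%:C ^+ n).
Proof.
apply/polyP => n; rewrite !coef_poly; case: ifP => // n3.
rewrite !mxE /coef; congr (beta _ _ * _).
by apply/val_inj; rewrite /= !inordK// ltnW// ltnW// ltnW.
Qed.

Lemma symbol_rsubmx s (beta : 'M[C]_(2, 3 + 3)) (j : nat) :
  symbol s (rsubmx (row (inord j) beta))
  = \poly_(n < 3) (coef beta j.+1 n.+4 * s%:C ^+ n).
Proof.
apply/polyP => n; rewrite !coef_poly; case: ifP => // n3.
rewrite !mxE /coef; congr (beta _ _ * _).
by apply/val_inj; rewrite /= !inordK// ?addSn.
Qed.

(** The five quantities are the coefficients of degrees 0 to 4 of the
    determinant, up to the factors -1 and, in degrees 3 and 4, powers of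
    sigma1 sigma2. *)
Lemma interface_det_neq0 (beta : 'M[C]_(2, 3 + 3)) :
  let b j n := coef beta j n in
  let s1 := sigma1%:C in let s2 := sigma2%:C in
  b 1 4 * b 2 1 != b 1 1 * b 2 4
  \/ s1 * (b 1 5 * b 2 1 - b 1 1 * b 2 5)
       != s2 * (b 1 2 * b 2 4 - b 1 4 * b 2 2)
  \/ s1 ^+ 2 * (b 1 6 * b 2 1 - b 1 1 * b 2 6)
       + s1 * s2 * (b 1 5 * b 2 2 - b 1 2 * b 2 5)
       + s2 ^+ 2 * (b 1 4 * b 2 3 - b 1 3 * b 2 4) != 0
  \/ s1 * (b 1 6 * b 2 2 - b 1 2 * b 2 6)
       != s2 * (b 1 3 * b 2 5 - b 1 5 * b 2 3)
  \/ b 1 6 * b 2 3 != b 1 3 * b 2 6 ->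
  interface_det sigma1 sigma2 beta != 0.
Proof.
move=> b s1 s2 conds.
have s1C : s1 != 0 := real_neq0 sigma1_neq0.
have s2C : s2 != 0 := real_neq0 sigma2_neq0.
have s12C : s1 * s2 != 0 by rewrite mulf_neq0.
apply: contraPneq conds; rewrite /interface_det !symbol_lsubmx !symbol_rsubmx.
move=> /coef_quadratics_eq0 /= [E0 E1 E2 E3 E4].
move: E0 E1 E2 E3 E4; rewrite !expr0 !expr1 !mulr1 -/s1 -/s2.
move=> /esym E0 /esym E1 /esym E2 /esym E3 /esym E4.
rewrite /b; case=> [/eqP|[/eqP|[/eqP|[/eqP|/eqP]]]]; apply.
- by apply: (eq_from_scaled (oner_neq0 _) E0); ring.
- by apply: (eq_from_scaled (oner_neq0 _) E1); ring.
- by apply: (eq_from_scaled (oner_neq0 _) E2); ring.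
- by apply: (eq_from_scaled s12C E3); ring.
- by apply: (eq_from_scaled (expf_neq0 2 s12C) E4); ring.
Qed.

End WellPosedness.

(** * The number of interface conditions *)

Section NumberOfConditions.
Variables (R : realType) (sigma1 sigma2 T : R).
Local Notation C := R[i].
Hypotheses (sigma1_neq0 : sigma1 != 0) (sigma2_neq0 : sigma2 != 0).
Hypothesis T_gt0 : 0 < T.

(** A (4 + m) x 6 matrix with m < 2 has a null vector, which can be added to any
    solution for zero data. *)
Lemma underdetermined m (beta : 'M[C]_(m, 3 + 3)) k :
  (m < 2)%N -> ~ solvable_at sigma1 sigma2 T beta k.
Proof.
move=> m2 solv; pose A := calA sigma1 sigma2 beta k.
have /rowV0Pn [v /sub_kermxP vA v0] : kermx A^T != 0.
  rewrite kermx_eq0 /row_free mxrank_tr; apply/eqP => rA.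
  by have := rank_leq_row A; rewrite rA leqNgt ltn_add2l m2.
have AvT : A *m v^T = 0 by rewrite -[LHS]trmxK trmx_mul trmxK vA trmx0.
have adm : admissible T beta (source_data (fun _ _ => 0)).
  apply: admissible_source_data => // j.
  exact: continuous_on_zero.
have [X [AX uniqX]] := solv _ adm.
have XE := uniqX (X + v^T); move/eqP: v0; apply; apply: trmx_inj.
have {XE} : X = X + v^T by apply: XE; rewrite mulmxDr -/A AvT addr0.
by move=> XvE; apply: (addrI X); rewrite -XvE trmx0 addr0.
Qed.

(** For m > 2 the rows are dependent. A dependency cannot involve the global
    relations alone, so it has a nonzero weight on some interface condition j0,
    and any solution would force the weighted sum of the transformed sources to
    vanish; it does not when only the j0-th source is nonzero and is tuned to
    the frequency. *)
Lemma overdetermined m (beta : 'M[C]_(m, 3 + 3)) k :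
  (2 < m)%N -> k != 0 -> ~ solvable_at sigma1 sigma2 T beta k.
Proof.
move=> m2 k0 solv; pose A := calA sigma1 sigma2 beta k.
have /rowV0Pn [v /sub_kermxP vA v0] : kermx A != 0.
  rewrite kermx_eq0 /row_free; apply/eqP => rA.
  by have := rank_leq_col A; rewrite rA leqNgt (ltn_add2l 4 2) m2.
pose u := lsubmx v; pose w := rsubmx v.
have vE : v = row_mx u w by rewrite hsubmxK.
(* If w = 0, then v is a dependency between rows of the two relation blocks. *)
have w0 : w != 0.
  apply: contra_neq v0 => w0; move: vA.
  rewrite vE w0 /A mul_row_col mul0mx addr0.
  rewrite -[u]hsubmxK mul_row_block !mulmx0 addr0 add0r mulmxN -[RHS]row_mx0.
  move=> /eq_row_mx [u1 /eqP]; rewrite oppr_eq0 => /eqP u2.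
  move: u1 u2; rewrite -[RHS](mul0mx _ (relation_mx sigma1 k)).
  move=> /(row_free_inj (relation_mx_row_free sigma1_neq0 k0)) ->.
  rewrite -[RHS](mul0mx _ (relation_mx sigma2 k)).
  move=> /(row_free_inj (relation_mx_row_free sigma2_neq0 k0)) ->.
  by rewrite !row_mx0.
have [j0 wj0] : exists j0, w 0 j0 != 0.
  apply: contrapT => /forallNP w_all; move/eqP: w0; apply; apply/rowP => j.
  by rewrite [RHS]mxE; apply/eqP; apply: contrapT => /negP; exact: w_all.
pose f j := if j == j0 then resonant_source T (omega k) else fun=> 0.
have adm : admissible T beta (source_data f).
  apply: admissible_source_data => j; rewrite /f; case: eqP => _ //.
  - exact: resonant_source_continuous.
  - exact: continuous_on_zero.
  - exact: resonant_source_ends.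
have [X [AX _]] := solv _ adm; move/(congr1 (mulmx v)): AX.
rewrite mulmxA vA mul0mx rhs_source_data vE mul_row_col mulmx0 add0r.
move=> /(congr1 (fun M : 'M[C]_1 => M 0 0)); rewrite !mxE (bigD1 j0) //= big1.
  rewrite mxE /f eqxx tilde_resonant_source // addr0 => /esym/eqP.
  rewrite mulf_eq0 (negbTE wj0) /= eq_complex /= eqxx andbT => /eqP T30.
  have := exprn_gt0 3 T_gt0; lra.
by move=> j /negbTE jj0; rewrite mxE /f jj0 tilde_zero mulr0.
Qed.

Lemma system_solvable_size m (beta : 'M[C]_(m, 3 + 3)) :
  system_solvable sigma1 sigma2 T beta -> m = 2%N.
Proof.
move=> /closure_D5_escapes_finite_set [k [k0 D5k not_sing]].
case: (ltngtP m 2) => // m2; case: not_sing; split => //.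
  exact: underdetermined.
exact: overdetermined.
Qed.

(** Continuity of q and of q_x across the interface. *)
Definition transmission_conditions : 'M[C]_(2, 3 + 3) :=
  row_mx (pid_mx 2) (- pid_mx 2).

(** Every combination of these conditions has opposite coefficients on the two
    sides, so none involves one side only. *)
Lemma transmission_conditions_coupled :
  ~ half_line_pair transmission_conditions.
Proof.
move=> [b [b' [/andP [_ sub] cases]]].
have /submxP [D bE] : (b <= transmission_conditions)%MS.
  by apply: submx_trans sub; rewrite -addsmxE addsmxSl.
have bLR : rsubmx b = - lsubmx b.
  by rewrite bE mul_mx_row row_mxKl row_mxKr mulmxN.
case: cases => [[b0 bR0 _]|[b0 bL0 _]]; move/eqP: b0; apply.
  by apply/eqP; rewrite -oppr_eq0 -bLR bR0.
by rewrite bLR bL0 oppr0.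
Qed.

(** The determinant is (sigma1 - sigma2) x up to sign, so its coefficient of
    degree 1 is the nonzero one. *)
Lemma transmission_conditions_solvable : sigma1 != sigma2 ->
  system_solvable sigma1 sigma2 T transmission_conditions.
Proof.
move=> s12; suff /(well_posed sigma1_neq0 sigma2_neq0 T) [] :
  interface_det sigma1 sigma2 transmission_conditions != 0 by [].
have coefL j n : (j < 2)%N -> (n < 3)%N ->
    coef transmission_conditions j.+1 n.+1 = (j == n)%:R.
  move=> j2 n3; rewrite /coef (_ : inord n = lshift 3 (inord n : 'I_3)).
    by rewrite row_mxEl mxE /= !inordK // j2 andbT.
  by apply/val_inj; rewrite /= !inordK// ltnW// ltnW// ltnW.
have coefR j n : (j < 2)%N -> (n < 3)%N ->
    coef transmission_conditions j.+1 n.+4 = - (j == n)%:R.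
  move=> j2 n3; rewrite /coef (_ : inord n.+3 = rshift 3 (inord n : 'I_3)).
    by rewrite row_mxEr !mxE /= !inordK // j2 andbT.
  by apply/val_inj; rewrite /= !inordK// ?addSn.
apply: interface_det_neq0 => //=; right; left.
rewrite !(coefL 0 0, coefL 0 1, coefL 1 0, coefL 1 1)%N //.
rewrite !(coefR 0 0, coefR 0 1, coefR 1 0, coefR 1 1)%N //=.
rewrite (_ : _ * _ = sigma1%:C); last by ring.
rewrite (_ : sigma2%:C * _ = sigma2%:C); last by ring.
by apply: contra_neq s12 => -[].
Qed.

End NumberOfConditions.

Unset Implicit Arguments.

Theorem proposition1 (R : realType) (sigma1 sigma2 T : R)
    (hT : 0 < T) (hsigma1 : 0 < sigma1) (hsigma2 : sigma2 < 0) :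
  (forall m : nat,
     (exists beta : 'M[R[i]]_(m, 3 + 3),
        ~ half_line_pair beta /\ system_solvable sigma1 sigma2 T beta) <-> m = 2%N)
  /\
  (forall beta : 'M[R[i]]_(2, 3 + 3),
     ~ half_line_pair beta ->
     let b11 := coef beta 1 1 in let b12 := coef beta 1 2 in
     let b13 := coef beta 1 3 in
     let b14 := coef beta 1 4 in let b15 := coef beta 1 5 in
     let b16 := coef beta 1 6 in
     let b21 := coef beta 2 1 in let b22 := coef beta 2 2 in
     let b23 := coef beta 2 3 in
     let b24 := coef beta 2 4 in let b25 := coef beta 2 5 in
     let b26 := coef beta 2 6 in
     let s1 := sigma1%:C in let s2 := sigma2%:C in
     b14 * b21 != b11 * b24
     \/ s1 * (b15 * b21 - b11 * b25) != s2 * (b12 * b24 - b14 * b22)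
     \/ s1 ^+ 2 * (b16 * b21 - b11 * b26)
          + s1 * s2 * (b15 * b22 - b12 * b25)
          + s2 ^+ 2 * (b14 * b23 - b13 * b24) != 0
     \/ s1 * (b16 * b22 - b12 * b26) != s2 * (b13 * b25 - b15 * b23)
     \/ b16 * b23 != b13 * b26 ->
     full_rank sigma1 sigma2 beta /\ system_solvable sigma1 sigma2 T beta).
Proof.
have s1_neq0 : sigma1 != 0 by rewrite gt_eqF.
have s2_neq0 : sigma2 != 0 by rewrite lt_eqF.
split=> [m|beta _ b11 b12 b13 b14 b15 b16 b21 b22 b23 b24 b25 b26 s1 s2 conds].
- split=> [[beta [_ solv]]|->]; first exact: system_solvable_size solv.
  exists (transmission_conditions R); split.
    exact: transmission_conditions_coupled.
  apply: transmission_conditions_solvable => //.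
  by rewrite gt_eqF // (lt_trans hsigma2).
- exact/well_posed/interface_det_neq0.
Qed.
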